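(* Let $k$ be a commutative Noetherian ring, and suppose that $\mathcal{C}$ has a generic shift functor $S$ (with natural transformation $\mu:\mathrm{Id}\to S$) such that $S M(s)$ is finitely presented for every $s \geqslant 0$. Let (P) be a property of some $\mathcal{C}$-modules and suppose that the zero $\mathcal{C}$-module has property (P). Then every finitely generated $\mathcal{C}$-module has property (P) if and only if the following three conditions hold: (C1) for every finitely generated $\mathcal{C}$-module $V$, if $SV$ has property (P), then $V$ has property (P); (C2) for every finitely generated $\mathcal{C}$-module $V$, if $DV$ has property (P) and $KV=0$, then $V$ has property (P); (C3) in every short exact sequence $0\to V'\to V\to V''\to 0$ of finitely generated $\mathcal{C}$-modules, if $V'$ and $V''$ have property (P), then $V$ has property (P).
   Context: Let $k$ be a commutative ring with identity. $\mathcal{C}$ denotes a category whose objects are the nonnegative integers, which is $k$-linear (enriched over $k$-modules), locally finite (each $\mathcal{C}(r,s)$ is a finitely generated $k$-module) and directed ($\mathcal{C}(r,s)=0$ whenever $r>s$). A $\mathcal{C}$-module $V$ is a covariant $k$-linear functor from $\mathcal{C}$ to $k$-modules; write $V_s=V(s)$. It is finitely generated if it contains a finite set of elements (of the various $V_s$) contained in no proper submodule. For $s\geqslant 0$, $M(s)=\mathcal{C}(s,-)$ is the representable (projective) $\mathcal{C}$-module. $V$ is generated in degrees $\leqslant s$ if the only submodule of $V$ containing $V_r$ for all $r\leqslant s$ is $V$; $V$ is generated in degrees $\leqslant -1$ if $V=0$. A $\mathcal{C}$-module is finitely presented if it has a projective resolution $\cdots\to P^2\to P^1\to P^0\to V\to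 0$ with $P^0$ and $P^1$ finitely generated. A self-embedding functor of degree 1 is a faithful ($k$-linear) functor $\iota:\mathcal{C}\to\mathcal{C}$ with $\iota(s)=s+1$ for all $s\geqslant 0$. A shift functor is the pull-back functor $S=\iota^*$ on the category of all $\mathcal{C}$-modules, $SV=V\circ\iota$ (so $(SV)_s=V_{s+1}$), for such an $\iota$. A shift functor $S$ is generic if there is a natural transformation $\mu:\mathrm{Id}\to S$ such that for every $s\geqslant 0$ the map $\mu_{M(s)}:M(s)\to SM(s)$ is injective and its cokernel is generated in degrees $\leqslant s-1$. For a $\mathcal{C}$-module $V$, $KV$ and $DV$ denote respectively the kernel and the cokernel of $\mu_V:V\to SV$. A property (P) of some $\mathcal{C}$-modules means a function from $\mathcal{C}$-modules to $\{\mathrm{Yes},\mathrm{No}\}$; $V$ has property (P) if its value is $\mathrm{Yes}$. (If $V$ is finitely generated, then so are $SV$ and $DV$.) *)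

(* Defs.v *)
From HB Require Import structures.
From mathcomp Require Import all_boot all_algebra.
From mathcomp Require Import boolp classical_sets.

Set Implicit Arguments.
Unset Strict Implicit.
Unset Printing Implicit Defensive.

Import GRing.Theory.
Local Open Scope ring_scope.
Local Open Scope classical_set_scope.
Local Open Scope quotient_scope.

(* Ideals need not be decidable nor proper, hence Prop-valued sets instead of
   ring_quotient's [idealr]. *)
Definition is_ideal (k : comPzRingType) (I : set k) : Prop :=
  I 0 /\ forall a x y : k, I x -> I y -> I (a * x + y).

Definition noetherian (k : comPzRingType) : Prop :=
  forall I : set k, is_ideal I ->
    exists (n : nat) (g : 'I_n -> k),
      I = [set x | exists c : 'I_n -> k, x = \sum_(i < n) c i * g i].

Definition lmod_fin_gen (k : comPzRingType) (M : lmodType k) : Prop :=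
  exists (n : nat) (g : 'I_n -> M),
    forall x, exists c : 'I_n -> k, x = \sum_(i < n) c i *: g i.

(* k-linear categories with set of objects {0, 1, 2, ...}; [comp g f] is the
   composite of f : r -> s followed by g : s -> t. *)
Record lin_cat (k : comPzRingType) := LinCat {
  hom :> nat -> nat -> lmodType k;
  idm : forall s, hom s s;
  comp : forall r s t, hom s t -> hom r s -> hom r t;
  comp_linear_l : forall r s t (f : hom r s), linear (fun g => @comp r s t g f);
  comp_linear_r : forall r s t (g : hom s t), linear (@comp r s t g);
  comp_id_l : forall r s (f : hom r s), comp (idm s) f = f;
  comp_id_r : forall r s (f : hom r s), comp f (idm r) = f;
  compA : forall r s t u (h : hom t u) (g : hom s t) (f : hom r s),
    comp h (comp g f) = comp (comp h g) f
}.

Arguments idm {k} C s : rename.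
Arguments comp {k C r s t} : rename.

Definition locally_finite (k : comPzRingType) (C : lin_cat k) : Prop :=
  forall r s, lmod_fin_gen (C r s).

Definition directed (k : comPzRingType) (C : lin_cat k) : Prop :=
  forall r s, (s < r)%N -> forall f : C r s, f = 0.

(* Covariant k-linear functors from C to k-modules. *)
Record cmod (k : comPzRingType) (C : lin_cat k) := CMod {
  cmod_obj :> nat -> lmodType k;
  act : forall r s, C r s -> cmod_obj r -> cmod_obj s;
  act_linear_l : forall r s x, linear (fun f => @act r s f x);
  act_linear_r : forall r s f, linear (@act r s f);
  act_id : forall s x, act (idm C s) x = x;
  act_comp : forall r s t (g : C s t) (f : C r s) x,
    act (comp g f) x = act g (act f x)
}.

Arguments act {k C} V {r s} : rename.

(* Natural transformations with k-linear components. *)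
Record cmod_hom (k : comPzRingType) (C : lin_cat k) (V W : cmod C) := CModHom {
  app :> forall s, V s -> W s;
  app_linear : forall s, linear (@app s);
  app_nat : forall r s (f : C r s) x, app (act V f x) = act W f (app x)
}.

Arguments app {k C V W} f s _ : rename.

Record submod (k : comPzRingType) (C : lin_cat k) (V : cmod C) := Submod {
  sub_set :> forall s, set (V s);
  sub0 : forall s, @sub_set s 0;
  sub_lin : forall s a (x y : V s),
    @sub_set s x -> @sub_set s y -> @sub_set s (a *: x + y);
  sub_act : forall r s (f : C r s) x, @sub_set r x -> @sub_set s (act V f x)
}.

Arguments sub_set {k C V} W s _ : rename.

Definition full (k : comPzRingType) (C : lin_cat k) (V : cmod C)
    (W : submod V) : Prop :=
  forall s, W s = setT.

Definition is_zero (k : comPzRingType) (C : lin_cat k) (V : cmod C) : Prop :=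
  forall s (x : V s), x = 0.

Definition fin_gen (k : comPzRingType) (C : lin_cat k) (V : cmod C) : Prop :=
  exists (n : nat) (d : 'I_n -> nat) (v : forall i, V (d i)),
    forall W : submod V, (forall i, W (d i) (v i)) -> full W.

Definition gen_deg_le (k : comPzRingType) (C : lin_cat k) (V : cmod C)
    (s : nat) : Prop :=
  forall W : submod V, (forall r, (r <= s)%N -> W r = setT) -> full W.

(* "generated in degrees <= s - 1"; for s = 0 this means V = 0. *)
Definition gen_deg_le_pred (k : comPzRingType) (C : lin_cat k) (V : cmod C)
    (s : nat) : Prop :=
  if s is t.+1 then gen_deg_le V t else is_zero V.

Section BasicModules.
Variables (k : comPzRingType) (C : lin_cat k).

Definition cmod_zero : cmod C.
Proof.
refine (@CMod k C (fun=> 'rV[k]_0) (fun _ _ _ _ => 0) _ _ _ _).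
- abstract (by move=> r s x a f g; rewrite scaler0 addr0).
- abstract (by move=> r s f a x y; rewrite scaler0 addr0).
- abstract (by move=> s x; apply/rowP; case).
- abstract (by []).
Defined.

Definition repr_cmod (s : nat) : cmod C :=
  @CMod k C (C s) (fun r t => @comp k C s r t)
    (fun r t => @comp_linear_l k C s r t)
    (fun r t => @comp_linear_r k C s r t)
    (fun t => @comp_id_l k C s t)
    (fun r t u g f x => esym (compA g f x)).

End BasicModules.

Arguments cmod_zero {k} C.
Arguments repr_cmod {k} C s.

Section KernelImage.
Variables (k : comPzRingType) (C : lin_cat k) (V W : cmod C).
Variable f : cmod_hom V W.

Lemma app0 s : f s 0 = 0.
Proof.
have /= := app_linear f (-1) (0 : V s) 0; by rewrite !scaleN1r !addNr.
Qed.

Definition ker : submod V.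
Proof.
refine (@Submod k C V (fun s => [set x | f s x = 0]) _ _ _) => /=.
- abstract (by exact: app0).
- abstract (by move=> s a x y fx fy; rewrite app_linear fx fy scaler0 addr0).
- abstract (by move=> r s g x fx; rewrite app_nat fx;
    have /= := act_linear_r g (-1) (0 : W r) 0; rewrite !scaleN1r !addNr).
Defined.

Definition img : submod W.
Proof.
refine (@Submod k C W (fun s => range (f s)) _ _ _) => /=.
- abstract (by move=> s; exists 0 => //; exact: app0).
- abstract (by move=> s a _ _ [x _ <-] [y _ <-]; exists (a *: x + y) => //;
    exact: app_linear).
- abstract (by move=> r s g _ [x _ <-]; exists (act V g x) => //;
    exact: app_nat).
Defined.

End KernelImage.

Definition cmod_inj (k : comPzRingType) (C : lin_cat k) (V W : cmod C)
    (f : cmod_hom V W) : Prop :=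
  forall s, injective (f s).

Definition cmod_surj (k : comPzRingType) (C : lin_cat k) (V W : cmod C)
    (f : cmod_hom V W) : Prop :=
  forall s (y : W s), exists x, f s x = y.

Definition exact_at (k : comPzRingType) (C : lin_cat k) (U V W : cmod C)
    (f : cmod_hom U V) (g : cmod_hom V W) : Prop :=
  forall s, img f s = ker g s.

Definition short_exact (k : comPzRingType) (C : lin_cat k) (U V W : cmod C)
    (f : cmod_hom U V) (g : cmod_hom V W) : Prop :=
  [/\ cmod_inj f, exact_at f g & cmod_surj g].

Definition sub_zero (k : comPzRingType) (C : lin_cat k) (V : cmod C)
    (W : submod V) : Prop :=
  forall s, W s = [set 0].

(* The quotient module V / W, obtained degreewise from [Quotient.quot]. *)
Section Quotient.
Variables (k : comPzRingType) (C : lin_cat k) (V : cmod C) (W : submod V).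

Definition sub_pred (s : nat) : {pred V s} := fun x => `[< W s x >].
Arguments sub_pred s _ : clear implicits.

Lemma sub_pred_zmod s : zmod_closed (sub_pred s).
Proof.
split=> [|x y /asboolP Wx /asboolP Wy]; first exact/asboolP/sub0.
apply/asboolP; rewrite addrC -scaleN1r; exact: sub_lin.
Qed.

HB.instance Definition _ s :=
  GRing.isZmodClosed.Build (V s) (sub_pred s) (sub_pred_zmod s).

Definition quot_obj (s : nat) : Type := Quotient.quot (sub_pred s).

HB.instance Definition _ s := GRing.Zmodule.on (quot_obj s).

Definition quot_pi s (x : V s) : quot_obj s :=
  \pi_(Quotient.quot (sub_pred s)) x.
Definition quot_repr s (x : quot_obj s) : V s :=
  repr (x : Quotient.quot (sub_pred s)).

Lemma quot_reprK s (x : quot_obj s) : quot_pi (quot_repr x) = x.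
Proof. exact: reprK. Qed.

Lemma quot_eqP s (x y : V s) : quot_pi x = quot_pi y <-> W s (x - y).
Proof.
split=> [/eqP|Wxy]; first by rewrite -Quotient.idealrBE => /asboolP.
by apply/eqP; rewrite -Quotient.idealrBE; apply/asboolP.
Qed.

Lemma quot_piD s (x y : V s) : quot_pi (x + y) = quot_pi x + quot_pi y.
Proof. exact: Quotient.pi_add. Qed.

Definition quot_scale s (a : k) (x : quot_obj s) : quot_obj s :=
  quot_pi (a *: quot_repr x).

Definition quot_act r s (f : C r s) (x : quot_obj r) : quot_obj s :=
  quot_pi (act V f (quot_repr x)).

Lemma quot_repr_pi s (x : V s) : W s (quot_repr (quot_pi x) - x).
Proof. by apply/quot_eqP; rewrite quot_reprK. Qed.

Lemma quot_pi_scale s a (x : V s) :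
  quot_scale a (quot_pi x) = quot_pi (a *: x).
Proof.
apply/quot_eqP; rewrite -scalerBr -[X in W s X]addr0.
by apply: sub_lin; [exact: quot_repr_pi | exact: sub0].
Qed.

Lemma quot_pi_act r s (f : C r s) (x : V r) :
  quot_act f (quot_pi x) = quot_pi (act V f x).
Proof.
apply/quot_eqP; rewrite addrC -scaleN1r -(act_linear_r f) scaleN1r addrC.
exact/sub_act/quot_repr_pi.
Qed.

Fact quot_scaleA s a b (x : quot_obj s) :
  quot_scale a (quot_scale b x) = quot_scale (a * b) x.
Proof. by rewrite -[x]quot_reprK !quot_pi_scale scalerA. Qed.

Fact quot_scale1 s : left_id 1 (@quot_scale s).
Proof. by move=> x; rewrite -[x]quot_reprK quot_pi_scale scale1r. Qed.

Fact quot_scaleDr s : right_distributive (@quot_scale s) +%R.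
Proof.
move=> a x y; rewrite -[x]quot_reprK -[y]quot_reprK -quot_piD.
by rewrite !quot_pi_scale scalerDr quot_piD.
Qed.

Fact quot_scaleDl s (x : quot_obj s) :
  {morph (@quot_scale s)^~ x : a b / a + b}.
Proof.
by move=> a b /=; rewrite -[x]quot_reprK !quot_pi_scale scalerDl quot_piD.
Qed.

HB.instance Definition _ s := GRing.Zmodule_isLmodule.Build k (quot_obj s)
  (@quot_scaleA s) (@quot_scale1 s) (@quot_scaleDr s) (@quot_scaleDl s).

Definition quot_cmod : cmod C.
Proof.
refine (@CMod k C (fun s => quot_obj s : lmodType k) quot_act _ _ _ _).
- abstract (by move=> r s x a f g;
    rewrite -[x]quot_reprK !quot_pi_act act_linear_l;
    rewrite quot_piD -quot_pi_scale).
- abstract (by move=> r s f a x y; rewrite -[x]quot_reprK -[y]quot_reprK;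
    rewrite [a *: _]quot_pi_scale -quot_piD !quot_pi_act act_linear_r;
    rewrite quot_piD -quot_pi_scale).
- abstract (by move=> s x; rewrite -[x]quot_reprK quot_pi_act act_id).
- abstract (by move=> r s t g f x;
    rewrite -[x]quot_reprK !quot_pi_act act_comp).
Defined.

End Quotient.

Definition coker (k : comPzRingType) (C : lin_cat k) (V W : cmod C)
    (f : cmod_hom V W) : cmod C :=
  quot_cmod (img f).

Definition projective (k : comPzRingType) (C : lin_cat k) (P : cmod C) : Prop :=
  forall (V W : cmod C) (g : cmod_hom V W) (f : cmod_hom P W),
    cmod_surj g ->
    exists h : cmod_hom P V, forall s x, g s (h s x) = f s x.

Definition fin_pres (k : comPzRingType) (C : lin_cat k) (V : cmod C) : Prop :=
  exists (P : nat -> cmod C) (d : forall n, cmod_hom (P n.+1) (P n))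
         (e : cmod_hom (P 0%N) V),
    [/\ forall n, projective (P n),
        cmod_surj e,
        exact_at (d 0%N) e,
        forall n, exact_at (d n.+1) (d n)
      & fin_gen (P 0%N) /\ fin_gen (P 1%N)].

(* A faithful k-linear endofunctor of C acting on objects by s |-> s + 1. *)
Record self_embedding (k : comPzRingType) (C : lin_cat k) := SelfEmbedding {
  emb :> forall r s, C r s -> C r.+1 s.+1;
  emb_linear : forall r s, linear (@emb r s);
  emb_id : forall s, emb (idm C s) = idm C s.+1;
  emb_comp : forall r s t (g : C s t) (f : C r s),
    emb (comp g f) = comp (emb g) (emb f);
  emb_inj : forall r s, injective (@emb r s)
}.

Arguments emb {k C} i {r s} : rename.

Section Shift.
Variables (k : comPzRingType) (C : lin_cat k) (i : self_embedding C).

Definition shift (V : cmod C) : cmod C.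
Proof.
refine (@CMod k C (fun s => V s.+1) (fun r s f => act V (emb i f)) _ _ _ _).
- abstract (by move=> r s x a f g; rewrite emb_linear act_linear_l).
- abstract (by move=> r s f; exact: act_linear_r).
- abstract (by move=> s x; rewrite emb_id act_id).
- abstract (by move=> r s t g f x; rewrite emb_comp act_comp).
Defined.

Definition shift_hom (V W : cmod C) (f : cmod_hom V W) :
  cmod_hom (shift V) (shift W).
Proof.
refine (@CModHom k C (shift V) (shift W) (fun s => f s.+1) _ _).
- abstract (by move=> s a x y; exact: (app_linear f a x y)).
- abstract (by move=> r s g x; exact: (app_nat f (emb i g) x)).
Defined.

(* Natural transformations Id -> S. *)
Record id_to_shift := IdToShift {
  mu_app :> forall V : cmod C, cmod_hom V (shift V);
  mu_nat : forall (V W : cmod C) (f : cmod_hom V W) s (x : V s),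
    mu_app W s (f s x) = shift_hom f s (mu_app V s x)
}.

End Shift.

Definition generic (k : comPzRingType) (C : lin_cat k) (i : self_embedding C)
    (mu : id_to_shift i) : Prop :=
  forall s, cmod_inj (mu (repr_cmod C s))
    /\ gen_deg_le_pred (coker (mu (repr_cmod C s))) s.

Definition kerK (k : comPzRingType) (C : lin_cat k) (i : self_embedding C)
    (mu : id_to_shift i) (V : cmod C) : submod V := ker (mu V).

Definition cokerD (k : comPzRingType) (C : lin_cat k) (i : self_embedding C)
    (mu : id_to_shift i) (V : cmod C) : cmod C := coker (mu V).

(* Main.v *)
Require Import Defs.
From mathcomp Require Import all_boot all_algebra.
From mathcomp Require Import boolp classical_sets.

Set Implicit Arguments.
Unset Strict Implicit.
Unset Printing Implicit Defensive.

Import GRing.Theory.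
Local Open Scope ring_scope.
Local Open Scope classical_set_scope.

(** Write m_s : s -> s+1 for the arrow such that mu_V is multiplication by the
    m_s; it exists by the Yoneda lemma ([mu_act]).  For a submodule U of V, let
    [colon mu U] consist of the x with mu_V x in U; it contains U.

    The first step is that finitely generated modules are Noetherian, in the
    sense of the ascending chain condition.  The main tool is [noeth_coker], a
    form of Hilbert's basis theorem: if DV is Noetherian and so is the k-module
    V_0, then V is Noetherian.  The place of the ideals of leading coefficients
    is taken by the images in DV of S(colon^n U), which together with the
    degree 0 parts of the colon^n U determine U, by induction on the degree.
    As DM(s) is generated in degrees < s, it is a quotient of a finite sum of
    M(r) with r < s, so every M(s) is Noetherian by induction on s
    ([noeth_repr]).

    The second step is an induction on s, for the finitely generated V that are
    generated in degrees < s.  Then DV is generated in degrees < s - 1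
    ([gen_lt_coker]), as are the modules D(V/U), so these have the property.
    For every U the map mu of V/U induces a short exact sequence
    0 -> V / colon mu U -> S(V/U) -> D(V/U) -> 0, so that the
    property passes from V / colon mu U to S(V/U), being closed under
    extensions, and then to V/U, by the condition on S ([P_quot_colon]).  Starting from
    U = 0 the iterated colons form an ascending chain, which stops at some K
    with K = colon mu K, that is, with mu injective on V/K.  By the condition on D
    the property holds for V/K, and one descends along the chain to V/0 = V ([P_noeth]). *)

(** * Ascending chains in preorders *)

Definition preorder (T : Type) (le : T -> T -> Prop) : Prop :=
  (forall x, le x x) /\ (forall y x z, le x y -> le y z -> le x z).

Definition acc (T : Type) (le : T -> T -> Prop) : Prop :=
  forall u : nat -> T, (forall n, le (u n) (u n.+1)) ->
    exists N, forall n, (N <= n)%N -> le (u n) (u N).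

Lemma chain_le (T : Type) (le : T -> T -> Prop) (u : nat -> T) :
  preorder le -> (forall n, le (u n) (u n.+1)) ->
  forall m n, (m <= n)%N -> le (u m) (u n).
Proof.
move=> [le_refl le_trans] u_incr m n /subnK <-.
elim: (n - m)%N => [|p IHp]; first exact: le_refl.
by rewrite addSn; apply: le_trans IHp (u_incr _).
Qed.

(** A chain in [T] stabilises as soon as its images under finitely many monotone
    maps do, provided that these maps jointly detect equality in each comparable
    pair. *)
Lemma acc_pullback2 (T T1 T2 : Type) (le : T -> T -> Prop)
    (le1 : T1 -> T1 -> Prop) (le2 : T2 -> T2 -> Prop)
    (f1 : T -> T1) (f2 : T -> T2) :
  preorder le -> preorder le1 -> preorder le2 ->
  (forall x y, le x y -> le1 (f1 x) (f1 y)) ->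
  (forall x y, le x y -> le2 (f2 x) (f2 y)) ->
  (forall x y, le x y -> le1 (f1 y) (f1 x) -> le2 (f2 y) (f2 x) -> le y x) ->
  acc le1 -> acc le2 -> acc le.
Proof.
move=> ord ord1 ord2 f1_homo f2_homo f_refl acc1 acc2 u u_incr.
have u_le := chain_le ord u_incr.
have [N1 stab1] := acc1 (f1 \o u) (fun n => f1_homo _ _ (u_incr n)).
have [N2 stab2] := acc2 (f2 \o u) (fun n => f2_homo _ _ (u_incr n)).
exists (maxn N1 N2) => n le_n; apply: f_refl (u_le _ _ le_n) _ _.
  apply: (ord1.2 (f1 (u N1))); last exact/f1_homo/u_le/leq_maxl.
  exact/stab1/(leq_trans (leq_maxl _ _) le_n).
apply: (ord2.2 (f2 (u N2))); last exact/f2_homo/u_le/leq_maxr.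
exact/stab2/(leq_trans (leq_maxr _ _) le_n).
Qed.

Lemma acc_pullback (T T1 : Type) (le : T -> T -> Prop)
    (le1 : T1 -> T1 -> Prop) (f : T -> T1) :
  preorder le -> preorder le1 ->
  (forall x y, le x y -> le1 (f x) (f y)) ->
  (forall x y, le x y -> le1 (f y) (f x) -> le y x) ->
  acc le1 -> acc le.
Proof.
move=> ord ord1 f_homo f_refl acc1.
by apply: (acc_pullback2 ord ord1 ord1 f_homo f_homo) => // x y le_xy le_fyx _;
  apply: f_refl.
Qed.

(** The bound J is uniform in n: beyond the point (N, N) where the diagonal chain
    stabilises the family is constant, and only the finitely many chains with
    n < N remain. *)
Lemma acc_double (T : Type) (le : T -> T -> Prop) (a : nat -> nat -> T) :
  preorder le -> acc le ->
  (forall j n, le (a j n) (a j.+1 n)) -> (forall j n, le (a j n) (a j n.+1)) ->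
  exists J, forall j, (J <= j)%N -> forall n, le (a j n) (a J n).
Proof.
move=> ord acc_le incr_j incr_n.
have [le_refl le_trans] := ord.
have le_j n := chain_le ord (fun j => incr_j j n).
have le_n j := chain_le ord (incr_n j).
have [N stabN] : exists N, forall n, (N <= n)%N -> le (a n n) (a N N).
  by apply: (acc_le (fun n => a n n)) => n; apply: le_trans (incr_j _ _) _.
have [J0 stabJ0] : exists J0, forall n, (n < N)%N ->
    forall j, (J0 <= j)%N -> le (a j n) (a J0 n).
  elim: N {stabN} => [|N [J1 stabJ1]]; first by exists 0%N.
  have [J2 stabJ2] := acc_le (a^~ N) (incr_j^~ N).
  exists (maxn J1 J2) => n; rewrite ltnS leq_eqVlt => /predU1P[->|ltnN] j.
    rewrite geq_max => /andP[_ /stabJ2 le_j2].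
    exact: le_trans le_j2 (le_j _ _ _ (leq_maxr _ _)).
  rewrite geq_max => /andP[/(stabJ1 n ltnN) le_j1 _].
  exact: le_trans le_j1 (le_j _ _ _ (leq_maxl _ _)).
exists (maxn J0 N) => j; rewrite geq_max => /andP[leJ0j leNj] n.
have [ltnN|leNn] := ltnP n N.
  by apply: le_trans (stabJ0 n ltnN j leJ0j) (le_j _ _ _ (leq_maxl _ _)).
have le_jn := leq_maxl j n; have le_nj := leq_maxr j n.
apply: (le_trans _ _ _ (le_j n _ _ le_jn)).
apply: (le_trans _ _ _ (le_n _ _ _ le_nj)).
apply: (le_trans _ _ _ (stabN _ (leq_trans leNj le_jn))).
exact: le_trans (le_j N _ _ (leq_maxr J0 N)) (le_n _ _ _ leNn).
Qed.

(** * Submodules, images and preimages *)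

Section Linear.
Variables (k : comPzRingType) (C : lin_cat k).
Implicit Types V W : cmod C.

Lemma subD V (U : submod V) s (x y : V s) : U s x -> U s y -> U s (x + y).
Proof. by move=> Ux Uy; rewrite -[x]scale1r; apply: sub_lin. Qed.

Lemma subZ V (U : submod V) s a (x : V s) : U s x -> U s (a *: x).
Proof. by move=> Ux; rewrite -[_ *: _]addr0; apply: sub_lin; last exact: sub0. Qed.

Lemma subN V (U : submod V) s (x : V s) : U s x -> U s (- x).
Proof. by rewrite -scaleN1r; apply: subZ. Qed.

Lemma subB V (U : submod V) s (x y : V s) : U s x -> U s y -> U s (x - y).
Proof. by move=> Ux Uy; apply/subD/subN. Qed.

Lemma sub_sum V (U : submod V) s n (c : 'I_n -> k) (g : 'I_n -> V s) :
  (forall j, U s (g j)) -> U s (\sum_(j < n) c j *: g j).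
Proof.
move=> Ug; apply: (big_ind (U s)) => [|x y|j _]; [exact: sub0|exact: subD|].
exact: subZ.
Qed.

Lemma appD V W (f : cmod_hom V W) s (x y : V s) : f s (x + y) = f s x + f s y.
Proof. by have:= app_linear f 1 x y; rewrite !scale1r. Qed.

Lemma appZ V W (f : cmod_hom V W) s a (x : V s) : f s (a *: x) = a *: f s x.
Proof. by rewrite -[_ *: _]addr0 app_linear app0 addr0. Qed.

Lemma appB V W (f : cmod_hom V W) s (x y : V s) : f s (x - y) = f s x - f s y.
Proof. by rewrite -!scaleN1r appD appZ. Qed.

Lemma lmod_fin_gen_surj V W (f : cmod_hom V W) s :
  cmod_surj f -> lmod_fin_gen (V s) -> lmod_fin_gen (W s).
Proof.
move=> f_surj [n [g g_gen]]; exists n, (fun j => f s (g j)) => y.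
have [x <-] := f_surj s y; have [c ->] := g_gen x; exists c.
rewrite (big_morph (f s) (@appD V W f s) (app0 f s)).
by apply: eq_bigr => j _; rewrite appZ.
Qed.

Definition sub_full V : submod V :=
  @Submod k C V (fun=> setT) (fun=> I) (fun _ _ _ _ _ _ => I) (fun _ _ _ _ _ => I).

Definition sub_null V : submod V.
Proof.
refine (@Submod k C V (fun s => [set 0]) _ _ _).
- abstract by [].
- abstract by move=> s a x y -> ->; rewrite scaler0 addr0.
- abstract by move=> r s f _ ->;
    have := act_linear_r f (-1) (0 : V r) 0; rewrite !scaleN1r !addNr.
Defined.

Definition preimage V W (f : cmod_hom V W) (U : submod W) : submod V.
Proof.
refine (@Submod k C V (fun s => [set x | U s (f s x)]) _ _ _) => /=.
- abstract by move=> s; rewrite app0; apply: sub0.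
- abstract by move=> s a x y Ux Uy; rewrite app_linear; apply: sub_lin.
- abstract by move=> r s g x Ux; rewrite app_nat; apply: sub_act.
Defined.

Definition image V W (f : cmod_hom V W) (U : submod V) : submod W.
Proof.
refine (@Submod k C W (fun s => f s @` U s) _ _ _) => /=.
- abstract by move=> s; exists 0; [exact: sub0 | exact: app0].
- abstract by move=> s a _ _ [x Ux <-] [y Uy <-]; exists (a *: x + y);
    [exact: sub_lin | exact: app_linear].
- abstract by move=> r s g _ [x Ux <-]; exists (act V g x);
    [exact: sub_act | exact: app_nat].
Defined.

Definition sum_sub V (U W : submod V) : submod V.
Proof.
refine (@Submod k C V
  (fun s => [set x | exists y, U s y /\ W s (x - y)]) _ _ _) => /=.
- abstract by move=> s; exists 0; rewrite subr0; split; apply: sub0.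
- abstract by move=> s a x y [x' [Ux' Wx']] [y' [Uy' Wy']];
    exists (a *: x' + y'); split; first exact: sub_lin;
    rewrite opprD addrACA -scalerBr; apply: sub_lin.
- abstract by move=> r s f x [y [Uy Wy]]; exists (act V f y);
    split; first exact: sub_act; rewrite addrC -scaleN1r -(act_linear_r f);
    rewrite scaleN1r addrC; apply: sub_act.
Defined.

Lemma sum_subl V (U W : submod V) s x : U s x -> sum_sub U W s x.
Proof. by move=> Ux; exists x; rewrite subrr; split=> //; apply: sub0. Qed.

Lemma sum_subr V (U W : submod V) s x : W s x -> sum_sub U W s x.
Proof. by move=> Wx; exists 0; rewrite subr0; split=> //; apply: sub0. Qed.

Lemma full_setT V (U : submod V) s : U s = setT <-> forall x, U s x.
Proof. by split=> [-> //|Ufull]; apply/seteqP; split=> // x _; apply: Ufull. Qed.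

Lemma fullP V (U : submod V) : full U <-> forall s x, U s x.
Proof. by split=> Ufull s; apply/full_setT. Qed.

Definition quot_hom V (U : submod V) : cmod_hom V (quot_cmod U).
Proof.
refine (@CModHom k C V (quot_cmod U) (fun s x => quot_pi U x) _ _).
- abstract by move=> s a x y; rewrite quot_piD -quot_pi_scale.
- abstract by move=> r s f x; rewrite -quot_pi_act.
Defined.

Lemma quot_hom_surj V (U : submod V) : cmod_surj (quot_hom U).
Proof. by move=> s y; exists (quot_repr y); apply: quot_reprK. Qed.

Lemma quot_hom_eq0 V (U : submod V) s (x : V s) :
  quot_hom U s x = 0 <-> U s x.
Proof. by rewrite -(app0 (quot_hom U)) /= quot_eqP subr0. Qed.

(** The morphism M(r) -> V that the Yoneda lemma attaches to [x : V r]. *)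
Definition orbit V r (x : V r) : cmod_hom (repr_cmod C r) V.
Proof.
refine (@CModHom k C (repr_cmod C r) V (fun s f => act V f x) _ _).
- abstract by move=> s; apply: act_linear_l.
- abstract by move=> s t g f; apply: act_comp.
Defined.

Lemma img_orbit_self V r (x : V r) : img (orbit x) r x.
Proof. by exists (idm C r) => //; apply: act_id. Qed.

End Linear.

(** * Noetherian modules *)

Section Noetherian.
Variables (k : comPzRingType) (C : lin_cat k).
Implicit Types V W : cmod C.

(** Inclusion after intersection with [A], so that chains of submodules of [A]
    can be represented by chains of submodules of [V]. *)
Definition sub_le_in V (A U W : submod V) : Prop :=
  forall s x, A s x -> U s x -> W s x.

Definition noeth_sub V (A : submod V) : Prop := acc (sub_le_in A).

Definition noeth V : Prop := noeth_sub (sub_full V).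

Lemma sub_le_in_preorder V (A : submod V) : preorder (sub_le_in A).
Proof. by split=> [U|U W X le_WU le_UX] s x Ax // Wx; apply/le_UX/le_WU. Qed.

Lemma noeth_full V (A : submod V) : (forall s x, A s x) -> noeth_sub A -> noeth V.
Proof.
move=> Afull; apply: (acc_pullback (f := id)) => //;
  try exact: sub_le_in_preorder.
- by move=> U W le_UW s x _; apply: le_UW.
- by move=> U W _ le_WU s x _; apply: le_WU.
Qed.

Lemma noeth_null V : noeth_sub (sub_null V).
Proof. by move=> u _; exists 0%N => n _ s x -> _; apply: sub0. Qed.

(** For submodules of A + B, the pair of the trace on A and the trace of A + W on
    B detects equality, by the modular law. *)
Lemma noeth_sum V (A B : submod V) :
  noeth_sub A -> noeth_sub B -> noeth_sub (sum_sub A B).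
Proof.
move=> noethA noethB.
apply: (acc_pullback2 (f1 := id) (f2 := sum_sub A) _ _ _ _ _ _ noethA noethB);
  try exact: sub_le_in_preorder.
- by move=> U W le_UW s x Ax; apply/le_UW/sum_subl.
- move=> U W le_UW s x Bx [a [Aa Uxa]]; exists a; split=> //.
  by apply: le_UW => //; exists (- a); rewrite opprK subrK; split=> //; apply: subN.
- move=> U W le_UW le_WU_A le_WU_B s x [a [Aa Bxa]] Wx.
  have [|a' [Aa' Uxaa']] := le_WU_B _ _ Bxa.
    by exists (- a); rewrite opprK subrK; split=> //; apply: subN.
  have Aaa' : A s (a + a') by apply: subD.
  have Ux' : U s (x - (a + a')) by rewrite opprD addrA.
  rewrite -[x](subrK (a + a')); apply: subD => //; apply: le_WU_A => //.
  rewrite -[a + a'](subKr x); apply: subB => //; apply: le_UW => //; exists (- a').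
  by rewrite opprK opprD addrA subrK; split=> //; apply: subN.
Qed.

Lemma noeth_orbit V r (x : V r) :
  noeth (repr_cmod C r) -> noeth_sub (img (orbit x)).
Proof.
apply: (acc_pullback (f := preimage (orbit x))); try exact: sub_le_in_preorder.
- by move=> U W le_UW s f _; apply: le_UW; exists f.
- by move=> U W _ le_WU s _ [f _ <-]; apply: le_WU.
Qed.

(** Sums of cyclic submodules replace quotients of direct sums of
    representables. *)
Lemma noeth_sub_family V n (d : 'I_n -> nat) (v : forall j, V (d j)) :
  (forall j, noeth (repr_cmod C (d j))) ->
  exists A : submod V, noeth_sub A /\ forall j, A (d j) (v j).
Proof.
elim: n => [|n IHn] in d v * => noeth_d.
  by exists (sub_null V); split; [exact: noeth_null | case].
have [A [noethA Av]] := IHn _ (fun j => v (lift ord0 j)) (fun j => noeth_d _).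
exists (sum_sub (img (orbit (v ord0))) A); split.
  by apply: noeth_sum => //; apply/noeth_orbit.
move=> j; case: (unliftP ord0 j) => [j' ->|->]; first exact/sum_subr/Av.
exact/sum_subl/img_orbit_self.
Qed.

Lemma noeth_fin_gen V :
  (forall r, noeth (repr_cmod C r)) -> fin_gen V -> noeth V.
Proof.
move=> noethM [n [d [v v_gen]]].
have [A [noethA Av]] := noeth_sub_family v (fun j => noethM (d j)).
by apply: noeth_full noethA; apply/fullP/v_gen.
Qed.

(** Counting degrees strictly below [s] makes V = 0 the case s = 0. *)
Definition gen_lt V s : Prop :=
  forall W : submod V, (forall r, (r < s)%N -> forall x, W r x) ->
    forall t x, W t x.

Lemma gen_ltP V s : gen_deg_le_pred V s -> gen_lt V s.
Proof.
case: s => [V0|s V_gen] W Wfull; first by move=> t x; rewrite (V0 t x); apply: sub0.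
by apply/fullP/V_gen => r ltrs; apply/full_setT/Wfull.
Qed.

Lemma noeth_gen_lt V s :
  (forall r, (r < s)%N -> noeth (repr_cmod C r)) ->
  (forall r, (r < s)%N -> lmod_fin_gen (V r)) ->
  gen_lt V s -> noeth V.
Proof.
move=> noethM fgV V_gen.
suff [A [noethA Afull]] : exists A : submod V,
    noeth_sub A /\ forall r, (r < s)%N -> forall x, A r x.
  exact: noeth_full (V_gen A Afull) noethA.
elim: s noethM fgV {V_gen} => [|s IHs] noethM fgV.
  by exists (sub_null V); split=> //; apply: noeth_null.
have [r ltrs|r ltrs|A [noethA Afull]] := IHs; [exact/noethM/ltnW|exact/fgV/ltnW|].
have [n [g g_gen]] := fgV s (leqnn _).
have [B [noethB Bg]] := noeth_sub_family (V := V) g (fun=> noethM s (leqnn _)).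
exists (sum_sub A B); split; first exact: noeth_sum.
move=> r; rewrite ltnS leq_eqVlt => /predU1P[->|ltrs] x; last exact/sum_subl/Afull.
by apply: sum_subr; have [c ->] := g_gen x; apply: sub_sum.
Qed.

End Noetherian.

(** * Noetherian scalars *)

Section ConstantModules.
Variable k : comPzRingType.

(** All objects are isomorphic, with endomorphism ring k, so modules over this
    category are just k-modules: finitely generated k-modules become an instance
    of the theory of finitely generated modules over a linear category. *)
Definition indiscrete : lin_cat k.
Proof.
refine (@LinCat k (fun _ _ => k^o) (fun _ => 1) (fun _ _ _ g f => g * f)
  _ _ _ _ _).
- abstract by move=> r s t f a x y; rewrite mulrDl -[_ * x * f]mulrA.
- abstract by move=> r s t g a x y; rewrite mulrDr [g * _]mulrCA.
- abstract by move=> r s f; apply: mul1r.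
- abstract by move=> r s f; apply: mulr1.
- abstract by move=> r s t u h g f; apply: mulrA.
Defined.

Definition const_cmod (M : lmodType k) : cmod indiscrete.
Proof.
refine (@CMod k indiscrete (fun _ => M) (fun _ _ (f : k) x => f *: x) _ _ _ _).
- abstract by move=> r s x a f g /=; rewrite scalerDl scalerA.
- abstract by move=> r s f a x y; rewrite scalerDr !scalerA mulrC.
- abstract by move=> s x; apply: scale1r.
- abstract by move=> r s t g f x; rewrite scalerA.
Defined.

Lemma noeth_scalars : noetherian k -> noeth (repr_cmod indiscrete 0).
Proof.
move=> noeth_k u u_incr.
have u_le := chain_le (sub_le_in_preorder _) u_incr.
have move_deg (W : submod (repr_cmod indiscrete 0)) r s (x : k) : W r x -> W s x.
  by move=> Wx; have := sub_act (1 : indiscrete r s) Wx; rewrite /= mul1r.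
pose I : set k := fun x => exists n, u n 0%N x.
have [|n [g I_gen]] := noeth_k I.
  split=> [|a x y [n ux] [m uy]]; first by exists 0%N; apply: sub0.
  exists (maxn n m); apply: (sub_lin (s := 0%N)).
    exact: (u_le _ _ (leq_maxl _ _)) ux.
  exact: (u_le _ _ (leq_maxr _ _)) uy.
have Ig j : I (g j).
  rewrite I_gen; exists (fun j' => (j' == j)%:R).
  rewrite (bigD1 j) //= eqxx mul1r big1 ?addr0 // => j' /negPf->.
  by rewrite mul0r.
have [N uNg] := choice Ig.
exists (\max_j N j)%N => m _ s x _ /(move_deg _ s 0%N) ux.
have : I x by exists m.
rewrite I_gen => -[c ->]; apply: (move_deg _ 0%N).
have /(_ 0%N) := @sub_sum _ _ (repr_cmod indiscrete 0) (u (\max_j N j)%N).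
apply=> j.
exact: (u_le _ _ (leq_bigmax j)) (uNg j).
Qed.

Lemma noeth_const (M : lmodType k) :
  noetherian k -> lmod_fin_gen M -> noeth (const_cmod M).
Proof.
move=> /noeth_scalars noeth_k [n [g g_gen]].
have [A [noethA Ag]] := noeth_sub_family (V := const_cmod M) g (fun=> noeth_k).
apply: noeth_full noethA => s x; have [c ->] := g_gen x.
apply: sub_sum => j; have := sub_act (1 : indiscrete 0 s) (Ag j).
by rewrite /= scale1r.
Qed.

Definition const_sub (C : lin_cat k) (V : cmod C) s (W : submod V) :
  submod (const_cmod (V s)).
Proof.
refine (@Submod k indiscrete (const_cmod (V s)) (fun _ => W s) _ _ _).
- abstract by move=> r; apply: sub0.
- abstract by move=> r a x y; apply: sub_lin.
- abstract by move=> r t f x; apply: subZ.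
Defined.

End ConstantModules.

(** * Finite generation *)

Section FiniteGeneration.
Variables (k : comPzRingType) (C : lin_cat k).
Implicit Types V W : cmod C.

(** Any finite index type is allowed, in particular a dependent sum. *)
Lemma fin_gen_finType V (J : finType) (d : J -> nat) (v : forall j, V (d j)) :
  (forall W : submod V, (forall j, W (d j) (v j)) -> full W) -> fin_gen V.
Proof.
move=> v_gen; exists #|J|, (fun j => d (enum_val j)), (fun j => v (enum_val j)).
by move=> W Wv; apply: v_gen => j; rewrite -(enum_rankK j).
Qed.

Lemma fin_gen_surj V W (f : cmod_hom V W) :
  cmod_surj f -> fin_gen V -> fin_gen W.
Proof.
move=> f_surj [n [d [v v_gen]]]; exists n, d, (fun j => f _ (v j)) => U Uv.
have /fullP preU := v_gen (preimage f U) Uv.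
by apply/fullP => s y; have [x <-] := f_surj s y; apply: preU.
Qed.

Lemma fin_gen_quot V (U : submod V) : fin_gen V -> fin_gen (quot_cmod U).
Proof. exact/fin_gen_surj/quot_hom_surj. Qed.

Lemma fin_gen_lt V : fin_gen V -> exists s, gen_lt V s.
Proof.
move=> [n [d [v v_gen]]]; exists (\max_j d j).+1%N => W Wfull.
apply/fullP/v_gen => j; apply: Wfull; rewrite ltnS; exact: leq_bigmax.
Qed.

Lemma gen_lt_surj V W (f : cmod_hom V W) s :
  cmod_surj f -> gen_lt V s -> gen_lt W s.
Proof.
move=> f_surj V_gen U Ufull t y; have [x <-] := f_surj t y.
by apply: (V_gen (preimage f U)) => r ltrs z; apply: Ufull.
Qed.

(** Generation of V / U in degrees < s, expressed in V itself. *)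
Lemma gen_lt_quot V (U : submod V) s :
  gen_lt (quot_cmod U) s <->
  forall W : submod V, (forall t x, U t x -> W t x) ->
    (forall r, (r < s)%N -> forall x, W r x) -> forall t x, W t x.
Proof.
split=> [Q_gen W leUW Wfull t x|V_gen W Wfull t y].
  have [|x' Wx' /quot_eqP/leUW Wx'x] :=
      Q_gen (image (quot_hom U) W) _ t (quot_hom U t x).
    move=> r ltrs y; have [z <-] := quot_hom_surj y.
    by exists z => //; apply: Wfull.
  by rewrite -[x](subKr x'); apply: subB.
have [x <-] := quot_hom_surj y.
apply: (V_gen (preimage (quot_hom U) W)) => [r z /quot_hom_eq0 Uz|r ltrs z].
  by change (W r (quot_hom U r z)); rewrite Uz; apply: sub0.
exact: Wfull.
Qed.

End FiniteGeneration.

(** * The shift functor *)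

Section Shift.
Variables (k : comPzRingType) (C : lin_cat k) (i : self_embedding C).
Variable mu : id_to_shift i.
Implicit Types V W : cmod C.

Lemma mu_act V s (x : V s) :
  mu V s x = act V (mu (repr_cmod C s) s (idm C s)) x.
Proof. by rewrite -[x in LHS]act_id (mu_nat mu (orbit x)). Qed.

Definition shift_sub V (W : submod V) : submod (shift i V).
Proof.
refine (@Submod k C (shift i V) (fun s => W s.+1) _ _ _).
- abstract by move=> s; apply: sub0.
- abstract by move=> s a x y; apply: sub_lin.
- abstract by move=> r s f x; apply: sub_act.
Defined.

(** The largest submodule U of V with SU contained in W.  It reduces statements on
    generators of SV to statements on generators of V. *)
Definition unshift V (W : submod (shift i V)) : submod V.
Proof.
refine (@Submod k C V
  (fun s => [set x | forall t (f : C s t.+1), W t (act V f x)]) _ _ _).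
- abstract by move=> s t f; have /= := app0 (orbit (0 : V s)) t.+1;
    have := act_linear_r f (-1) (0 : V s) 0;
    rewrite !scaleN1r !addNr => -> _; apply: sub0.
- abstract by move=> s a x y Wx Wy t f; rewrite act_linear_r; apply: sub_lin.
- abstract by move=> r s g x Wx t f; rewrite -act_comp; apply: Wx.
Defined.

Lemma unshift_full V (W : submod (shift i V)) :
  (forall s x, unshift W s x) -> forall s x, W s x.
Proof. by move=> Wfull s x; rewrite -[x]act_id; apply: Wfull. Qed.

(** For a single x : V_r the condition takes place in S M(r). *)
Lemma unshift_orbit V (W : submod (shift i V)) r (x : V r) :
  (forall t f, preimage (shift_hom i (orbit x)) W t f) -> unshift W r x.
Proof. by []. Qed.

(** If the v_j generate V and the w_jl generate S M(d_j), then the w_jl v_j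
    generate SV. *)
Lemma fin_gen_shift V :
  (forall r, fin_gen (shift i (repr_cmod C r))) -> fin_gen V ->
  fin_gen (shift i V).
Proof.
move=> fgSM [n [d [v v_gen]]].
have {fgSM} fgSM j : exists p : {m : nat & {e : 'I_m -> nat &
    forall l, shift i (repr_cmod C (d j)) (e l)}},
    forall W : submod (shift i (repr_cmod C (d j))),
      (forall l, W (projT1 (projT2 p) l) (projT2 (projT2 p) l)) -> full W.
  have [m [e [w w_gen]]] := fgSM (d j).
  by exists (existT _ m (existT _ e w)).
pose p j := sval (cid (fgSM j)); have p_gen j := svalP (cid (fgSM j)).
apply: (@fin_gen_finType _ _ _ {j : 'I_n & 'I_(projT1 (p j))}
  (fun q => projT1 (projT2 (p (tag q))) (tagged q))
  (fun q => shift_hom i (orbit (v (tag q))) _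
              (projT2 (projT2 (p (tag q))) (tagged q)))).
move=> W Ww; apply/fullP/unshift_full/fullP/v_gen => j.
by apply/unshift_orbit/fullP/p_gen => l; apply: (Ww (Tagged _ l)).
Qed.

(** SV is covered by the images of S M(r) for r <= s, along the orbit maps of
    the elements of V_r; modulo the images of mu, each S M(r) is generated in
    degrees < r. *)
Lemma gen_lt_coker V s : generic mu -> gen_lt V s.+1 -> gen_lt (cokerD mu V) s.
Proof.
move=> gen_mu V_gen; apply/gen_lt_quot => W muW Wfull.
apply/unshift_full/V_gen => r le_rs x; apply: unshift_orbit.
have /gen_ltP/gen_lt_quot := (gen_mu r).2; apply.
  move=> t _ [f _ <-]; apply: muW; exists (orbit x t f) => //.
  exact: (mu_nat mu (orbit x)).
by move=> j ltjr f; apply/Wfull/(leq_trans ltjr).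
Qed.

Definition colon V (W : submod V) : submod V := preimage (mu V) (shift_sub W).

Lemma sub_colon V (W : submod V) s x : W s x -> colon W s x.
Proof. by move=> Wx; rewrite /colon /= mu_act; apply: sub_act. Qed.

(** The analogue of the ideal of leading coefficients. *)
Definition lead V (W : submod V) : submod (cokerD mu V) :=
  image (quot_hom (img (mu V))) (shift_sub W).

(** Hilbert's basis theorem.  Let U' contain U, such that colon^n U and colon^n U'
    agree in degree 0 and have the same [lead], for all n.  Let x be in
    (colon^n U')_{s+1}.  Equality of leads gives y in colon^n U with
    y - x = mu z; then z is in (colon^{n+1} U')_s, which is (colon^{n+1} U)_s
    by induction on s, so mu z, and hence x, is in colon^n U. *)
Lemma noeth_coker V :
  noeth (const_cmod (V 0%N)) -> noeth (cokerD mu V) -> noeth V.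
Proof.
move=> noeth0 noethD u u_incr.
have le_colon (U W : submod V) : (forall s x, U s x -> W s x) ->
    forall n s x, iter n (@colon V) U s x -> iter n (@colon V) W s x.
  by move=> leUW; elim=> //= n IHn s x; apply: IHn.
have u_le j s x : u j s x -> u j.+1 s x by apply: u_incr.
(* a j n is colon^n (u j); it increases in both indices. *)
pose a j n := iter n (@colon V) (u j).
have a_incr_j j n s x : a j n s x -> a j.+1 n s x by apply/le_colon/u_le.
have a_incr_n j n s x : a j n s x -> a j n.+1 s x by apply: sub_colon.
have [J1 stab1] : exists J, forall j, (J <= j)%N -> forall n x,
    a j n 0%N x -> a J n 0%N x.
  have [||J stab] := acc_double (a := fun j n => const_sub 0 (a j n))
      (sub_le_in_preorder _) noeth0.
  - by move=> j n s x _; apply: a_incr_j.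
  - by move=> j n s x _; apply: a_incr_n.
  by exists J => j leJj n x; apply: (stab j leJj n 0%N x I).
have [J2 stab2] : exists J, forall j, (J <= j)%N -> forall n s x,
    lead (a j n) s x -> lead (a J n) s x.
  have [||J stab] := acc_double (a := fun j n => lead (a j n))
      (sub_le_in_preorder _) noethD.
  - by move=> j n s _ _ [x ax <-]; exists x => //; apply: a_incr_j.
  - by move=> j n s _ _ [x ax <-]; exists x => //; apply: a_incr_n.
  by exists J => j leJj n s x; apply: (stab j leJj n s x I).
have a_le n s x j' j : (j' <= j)%N -> a j' n s x -> a j n s x.
  have a_chain l : sub_le_in (sub_full V) (a l n) (a l.+1 n).
    by move=> t y _; apply: a_incr_j.
  move=> le_j; exact: (chain_le (sub_le_in_preorder _) a_chain le_j s x I).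
exists (maxn J1 J2) => j; rewrite geq_max => /andP[leJ1j leJ2j].
suff stab s : forall n x, a j n s x -> a (maxn J1 J2) n s x.
  by move=> s x _; apply: (stab s 0%N).
elim: s => [|s IHs] n x ax.
  exact: a_le (leq_maxl _ _) (stab1 j leJ1j n x ax).
have [|y ay /quot_eqP[z _ def_z]] := stab2 j leJ2j n s (quot_hom (img (mu V)) s x).
  by exists x.
have aJy : a (maxn J1 J2) n s.+1 y by apply: a_le (leq_maxr _ _) ay.
have : a j n.+1 s z.
  change (a j n s.+1 (mu V s z)); rewrite def_z; apply: subB => //.
  exact: a_le leJ2j ay.
move=> /IHs aJz; rewrite -[x](subKr y) -def_z; apply: subB => //.
Qed.

End Shift.

(** * Induction on the generation degree *)

Definition cmod_comp (k : comPzRingType) (C : lin_cat k) (U V W : cmod C)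
    (g : cmod_hom V W) (f : cmod_hom U V) : cmod_hom U W.
Proof.
refine (@CModHom k C U W (fun s x => g s (f s x)) _ _).
- abstract by move=> s a x y; rewrite !app_linear.
- abstract by move=> r s h x; rewrite !app_nat.
Defined.

Section QuotientLift.
Variables (k : comPzRingType) (C : lin_cat k) (V X : cmod C) (U : submod V).
Variable f : cmod_hom V X.
Hypothesis fU0 : forall s x, U s x -> f s x = 0.

Let lift s (y : quot_cmod U s) : X s := f s (quot_repr y).

Let liftE s (x : V s) : lift (quot_hom U s x) = f s x.
Proof. by apply/eqP; rewrite -subr_eq0 -appB; apply/eqP/fU0/quot_repr_pi. Qed.

Definition quot_lift : cmod_hom (quot_cmod U) X.
Proof.
refine (@CModHom k C (quot_cmod U) X lift _ _).
- abstract by move=> s a y z; have [x <-] := quot_hom_surj y;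
    have [x' <-] := quot_hom_surj z; rewrite -app_linear !liftE app_linear.
- abstract by move=> r s g y; have [x <-] := quot_hom_surj y;
    rewrite -app_nat !liftE app_nat.
Defined.

Lemma quot_liftE s (x : V s) : quot_lift s (quot_hom U s x) = f s x.
Proof. exact: liftE. Qed.

Lemma quot_lift_inj :
  (forall s x, f s x = 0 -> U s x) -> cmod_inj quot_lift.
Proof.
move=> ker_f s y z; have [x <-] := quot_hom_surj y.
have [x' <-] := quot_hom_surj z; rewrite !quot_liftE => eq_f.
by apply/quot_eqP/ker_f; rewrite appB eq_f subrr.
Qed.

End QuotientLift.

Section Devissage.
Variables (k : comPzRingType) (C : lin_cat k) (i : self_embedding C).
Variable mu : id_to_shift i.
Implicit Types V W : cmod C.

(** Induction on s, as DM(s) is generated in degrees < s. *)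
Lemma noeth_repr : noetherian k -> locally_finite C -> generic mu ->
  forall s, noeth (repr_cmod C s).
Proof.
move=> noeth_k fgC gen_mu; elim/ltn_ind => s IHs.
apply: (noeth_coker (mu := mu)); first exact: noeth_const (fgC s 0%N).
apply: noeth_gen_lt IHs _ (gen_ltP (gen_mu s).2) => r _.
have Q_surj := quot_hom_surj (U := img (mu (repr_cmod C s))).
by apply: (lmod_fin_gen_surj (s := r) Q_surj); apply: fgC.
Qed.

Lemma fin_pres_fin_gen V : fin_pres V -> fin_gen V.
Proof. by move=> [Q [_ [e [_ e_surj _ _ [fgQ _]]]]]; apply: fin_gen_surj fgQ. Qed.

Lemma fin_gen_zero : fin_gen (cmod_zero C).
Proof.
by exists 0%N, (fun=> 0%N), (fun=> 0) => W _; apply/fullP => s x;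
  rewrite [x](_ : x = 0); [exact: sub0 | apply/rowP; case].
Qed.

Definition zero_hom V W : cmod_hom V W.
Proof.
refine (@CModHom k C V W (fun _ _ => 0) _ _).
- abstract by move=> s a x y; rewrite scaler0 addr0.
- abstract by move=> r s f x; have := act_linear_r f (-1) (0 : W r) 0;
    rewrite !scaleN1r !addNr.
Defined.

Section Property.
Variable P : cmod C -> bool.
Hypothesis P_zero : P (cmod_zero C).
Hypothesis P_shift : forall V, fin_gen V -> P (shift i V) -> P V.
Hypothesis P_coker : forall V,
  fin_gen V -> P (cokerD mu V) -> sub_zero (kerK mu V) -> P V.
Hypothesis P_ext : forall V' V V'' (f : cmod_hom V' V) (g : cmod_hom V V''),
  fin_gen V' -> fin_gen V -> fin_gen V'' -> short_exact f g ->
  P V' -> P V'' -> P V.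
Hypothesis fg_shift : forall V, fin_gen V -> fin_gen (shift i V).

(** [P] is an arbitrary predicate, so its invariance under isomorphism has to
    come from extensions, here of W by the zero module. *)
Lemma P_iso V W (f : cmod_hom V W) :
  fin_gen V -> cmod_inj f -> cmod_surj f -> P W -> P V.
Proof.
move=> fgV f_inj f_surj PW.
apply: (P_ext (f := zero_hom (cmod_zero C) V) (g := f)) => //.
- exact: fin_gen_zero.
- exact: fin_gen_surj fgV.
split=> // s; first by move=> x y _; apply/rowP; case.
apply/seteqP; split=> x /= [].
  by move=> _ _ <-; apply: app0.
by rewrite -(app0 f) => /f_inj->; exists 0.
Qed.

(** With Q = V / U, the map V -> Q -> SQ has kernel [colon mu U], hence there is
    a short exact sequence 0 -> V / colon mu U -> SQ -> DQ -> 0. *)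
Lemma P_quot_colon V (U : submod V) :
  fin_gen V -> P (cokerD mu (quot_cmod U)) ->
  P (quot_cmod (colon mu U)) -> P (quot_cmod U).
Proof.
move=> fgV PD Pcolon; have fgQ := fin_gen_quot U fgV; apply: P_shift => //.
pose f := cmod_comp (mu (quot_cmod U)) (quot_hom U).
have fP s (x : V s) : f s x = 0 <-> colon mu U s x.
  rewrite /= (mu_nat mu (quot_hom U)); exact: quot_hom_eq0.
pose h := quot_lift (fun s x => (fP s x).2).
apply: (P_ext (f := h) (g := quot_hom (img (mu (quot_cmod U))))) => //.
- exact: fin_gen_quot.
- exact: fg_shift.
- exact/fin_gen_quot/fg_shift.
- split; last exact: quot_hom_surj.
    by apply: quot_lift_inj => s x /fP.
  move=> s; apply/seteqP; split=> y.
    move=> [z _ <-]; have [x <-] := quot_hom_surj z.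
    by apply/quot_hom_eq0; rewrite quot_liftE; exists (quot_hom U s x).
  move=> /quot_hom_eq0[z _ <-]; have [x <-] := quot_hom_surj z.
  by exists (quot_hom (colon mu U) s x) => //; rewrite quot_liftE.
Qed.

(** [K] is the chain of the kernels of V -> S^n V; where it stops, mu becomes
    injective on the quotient. *)
Lemma P_noeth V : fin_gen V -> noeth V ->
  (forall U : submod V, P (cokerD mu (quot_cmod U))) -> P V.
Proof.
move=> fgV noethV PD.
pose K n : submod V := iter n (@colon _ _ _ mu V) (sub_null V).
have [N stab] := noethV K (fun n s x _ => @sub_colon _ _ _ mu V (K n) s x).
have PKN : P (quot_cmod (K N)).
  apply: P_coker => [||s]; [exact: fin_gen_quot|exact: PD|].
  apply/seteqP; split=> [y|_ ->]; last exact: app0.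
  have [x <-] := quot_hom_surj y; rewrite /= (mu_nat mu (quot_hom (K N))).
  move=> /quot_hom_eq0 Kx; apply/quot_hom_eq0; exact: (stab N.+1).
have PK n : (n <= N)%N -> P (quot_cmod (K (N - n)%N)).
  elim: n => [|n IHn] ltnN; first by rewrite subn0.
  apply: P_quot_colon => //.
  have -> : colon mu (K (N - n.+1)%N) = K (N - n)%N by rewrite -(subnSK ltnN).
  exact/IHn/ltnW.
have {PK} := PK N (leqnn N); rewrite subnn.
apply: (P_iso (f := quot_hom (K 0%N))) => //.
  by move=> s x y /quot_eqP xy0; apply/subr0_eq.
exact: quot_hom_surj.
Qed.

Lemma P_gen_lt : generic mu -> (forall V, fin_gen V -> noeth V) ->
  forall s V, fin_gen V -> gen_lt V s -> P V.
Proof.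
move=> gen_mu noethC; elim=> [|s IHs] V fgV V_gen.
  have V0 t x : sub_null V t x by apply: V_gen.
  apply: (P_iso (f := zero_hom V (cmod_zero C))) => // t x.
    by move=> y _; rewrite (V0 t x) (V0 t y).
  by exists 0; apply/rowP; case.
apply: P_noeth => // [|U]; first exact: noethC.
apply: IHs; first exact/fin_gen_quot/fg_shift/fin_gen_quot.
by apply: gen_lt_coker => //; apply: gen_lt_surj (quot_hom_surj (U := U)) V_gen.
Qed.

End Property.
End Devissage.

Theorem theorem1p8 (k : comPzRingType) (C : lin_cat k)
    (i : self_embedding C) (mu : id_to_shift i) (P : cmod C -> bool) :
  noetherian k ->
  locally_finite C ->
  directed C ->
  generic mu ->
  (forall s : nat, fin_pres (shift i (repr_cmod C s))) ->
  P (cmod_zero C) ->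
  (forall V : cmod C, fin_gen V -> P V) <->
  [/\ forall V : cmod C, fin_gen V -> P (shift i V) -> P V,
      forall V : cmod C, fin_gen V ->
        P (cokerD mu V) -> sub_zero (kerK mu V) -> P V
    & forall (V' V V'' : cmod C) (f : cmod_hom V' V) (g : cmod_hom V V''),
        fin_gen V' -> fin_gen V -> fin_gen V'' -> short_exact f g ->
        P V' -> P V'' -> P V].
Proof.
move=> noeth_k fgC _ gen_mu fpS P0; split=> [PC|[sh cok ext] V fgV].
  by split=> [V fgV _|V fgV _ _|V' V V'' f g _ fgV _ _ _ _]; apply: PC.
have [s V_gen] := fin_gen_lt fgV.
have noethM := noeth_repr noeth_k fgC gen_mu.
apply: (P_gen_lt P0 sh cok ext _ gen_mu _ fgV V_gen).
  by move=> W fgW; apply: fin_gen_shift fgW => r; apply/fin_pres_fin_gen/fpS.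
by move=> W; apply: noeth_fin_gen.
Qed.
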